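(* Let $R$ be a commutative ring with $1\neq 0$. The following are equivalent. (1) $R$ is indecomposable. (2) $\mathcal I\circ\mathcal S\cong 1_{\mathbf{BA}}$ (natural isomorphism of functors). (3) $\mathcal S\circ\mathcal I\cong 1_{\mathbf{Sp}_R}$ (natural isomorphism of functors). (4) The functors $\mathcal I$ and $\mathcal S$ yield an equivalence of the categories $\mathbf{Sp}_R$ and $\mathbf{BA}$.
   Context: All algebras are commutative and unital and all algebra homomorphisms are unital. $R$ is indecomposable if its only idempotents are $0$ and $1$. For a commutative $R$-algebra $S$, $\mathrm{Id}(S)$ is the set of idempotents of $S$, a Boolean algebra under $e\vee f=e+f-ef$, $e\wedge f=ef$, $\lnot e=1-e$. A nonzero idempotent $e\in S$ is faithful if for each $a\in R$, $ae=0$ implies $a=0$. A faithful generating algebra of idempotents of $S$ is a Boolean subalgebra $B$ of $\mathrm{Id}(S)$ that generates $S$ as an $R$-algebra and all of whose nonzero elements are faithful. $S$ is a Specker $R$-algebra if it is a commutative $R$-algebra that has a faithful generating algebra of idempotents. For a Boolean algebra $B$, $R[B]$ denotes the quotient $R[\{x_e: e\in B\}]/I_B$ of the polynomial ring over $R$ in variables indexed by $B$ modulo the ideal $I_B$ generated by the elements $x_{e\wedge f}-x_ex_f$, $x_{e\vee f}-(x_e+x_f-x_ex_f)$, $x_{\lnot e}-(1-x_e)$, $x_0$, as $e,f$ range over $B$; put $y_e=x_e+I_B$. $R[B]$ is a Specker $R$-algebra. $\mathbf{BA}$ is the category of Boolean algebras and Boolean homomorphisms (the one-element Boolean algebra is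 allowed); $\mathbf{Sp}_R$ is the category of Specker $R$-algebras and $R$-algebra homomorphisms. The functor $\mathcal I:\mathbf{Sp}_R\to\mathbf{BA}$ sends $S$ to $\mathrm{Id}(S)$ and $\alpha:S\to S'$ to its restriction $\alpha|_{\mathrm{Id}(S)}$. The functor $\mathcal S:\mathbf{BA}\to\mathbf{Sp}_R$ sends $B$ to $R[B]$ and a Boolean homomorphism $\sigma:B\to B'$ to the $R$-algebra homomorphism $R[B]\to R[B']$ with $y_e\mapsto y_{\sigma(e)}$. *)

(* Defs.v *)
From HB Require Import structures.
From mathcomp Require Import all_boot all_order all_algebra.
From mathcomp Require Import generic_quotient ring_quotient finmap.
From mathcomp Require Import boolp classical_sets.
From mathcomp Require Import monalg.

Set Implicit Arguments.
Unset Strict Implicit.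
Unset Printing Implicit Defensive.

Import Order.TTheory Order.CTheory GRing.Theory.

Local Open Scope ring_scope.

Record category := Category {
  obj :> Type;
  hom : obj -> obj -> Type;
  idm : forall X, hom X X;
  comp : forall X Y Z, hom Y Z -> hom X Y -> hom X Z;
  compfid : forall X Y (f : hom X Y), comp f (idm X) = f;
  compidf : forall X Y (f : hom X Y), comp (idm Y) f = f;
  compfA : forall X Y Z T (h : hom Z T) (g : hom Y Z) (f : hom X Y),
    comp h (comp g f) = comp (comp h g) f
}.

Arguments hom {c} X Y.
Arguments idm {c} X.
Arguments comp {c X Y Z} g f.

Record functor (C D : category) := Functor {
  fobj :> C -> D;
  fmor : forall X Y : C, hom X Y -> hom (fobj X) (fobj Y);
  fmor_id : forall X : C, fmor (idm X) = idm (fobj X);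
  fmor_comp : forall (X Y Z : C) (g : hom Y Z) (f : hom X Y),
    fmor (comp g f) = comp (fmor g) (fmor f)
}.

Arguments fmor {C D} F {X Y} f : rename.

Definition id_functor (C : category) : functor C C :=
  @Functor C C (fun X => X) (fun X Y f => f)
    (fun X => erefl) (fun X Y Z g f => erefl).

Section CompFunctor.
Variables (C D E : category) (G : functor D E) (F : functor C D).

Lemma comp_functor_id (X : C) : fmor G (fmor F (idm X)) = idm (G (F X)).
Proof. by rewrite !fmor_id. Qed.

Lemma comp_functor_comp (X Y Z : C) (g : hom Y Z) (f : hom X Y) :
  fmor G (fmor F (comp g f)) = comp (fmor G (fmor F g)) (fmor G (fmor F f)).
Proof. by rewrite !fmor_comp. Qed.

Definition comp_functor : functor C E :=
  @Functor C E (fun X => G (F X)) (fun X Y f => fmor G (fmor F f))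
    comp_functor_id comp_functor_comp.
End CompFunctor.

Definition is_iso (C : category) (X Y : C) (f : hom X Y) : Prop :=
  exists g : hom Y X, comp g f = idm X /\ comp f g = idm Y.

Definition nat_iso (C D : category) (F G : functor C D) : Prop :=
  exists eta : forall X : C, hom (F X) (G X),
    (forall (X Y : C) (f : hom X Y),
       comp (eta Y) (fmor F f) = comp (fmor G f) (eta X)) /\
    (forall X : C, is_iso (eta X)).

Definition yield_equivalence (C D : category) (F : functor C D)
    (G : functor D C) : Prop :=
  nat_iso (id_functor C) (comp_functor G F) /\
  nat_iso (id_functor D) (comp_functor F G).

(* ctbDistrLatticeType allows \bot = \top, so the one-element Boolean algebra
   is included. *)
Record boolAlg := BoolAlg {
  ba_disp : Order.disp_t;
  ba_sort :> ctbDistrLatticeType ba_disp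
}.

(* The library's {tblmorphism A -> B} only asks for the preservation of \bot
   and \top, hence this dedicated record. *)
Record boolHom (A B : boolAlg) := BoolHom {
  bool_fun :> A -> B;
  bool_hom0 : bool_fun \bot%O = \bot%O;
  bool_hom1 : bool_fun \top%O = \top%O;
  bool_homI : forall x y, bool_fun (x `&` y)%O = (bool_fun x `&` bool_fun y)%O;
  bool_homU : forall x y, bool_fun (x `|` y)%O = (bool_fun x `|` bool_fun y)%O;
  bool_homC : forall x, bool_fun (~` x)%O = (~` bool_fun x)%O
}.

Lemma boolHomP (A B : boolAlg) (f g : boolHom A B) : f =1 g -> f = g.
Proof.
case: f g => [f f0 f1 fI fU fC] [g g0 g1 gI gU gC] /= /funext fg.
rewrite -{}fg in g0 g1 gI gU gC *; congr BoolHom; exact: Prop_irrelevance.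
Qed.

Definition bool_id (A : boolAlg) : boolHom A A :=
  @BoolHom A A id erefl erefl (fun _ _ => erefl) (fun _ _ => erefl)
    (fun _ => erefl).

Section BoolComp.
Variables (A B C : boolAlg) (g : boolHom B C) (f : boolHom A B).

Let h x := g (f x).
Let h0 : h \bot%O = \bot%O. Proof. by rewrite /h !bool_hom0. Qed.
Let h1 : h \top%O = \top%O. Proof. by rewrite /h !bool_hom1. Qed.
Let hI x y : h (x `&` y)%O = (h x `&` h y)%O.
Proof. by rewrite /h !bool_homI. Qed.
Let hU x y : h (x `|` y)%O = (h x `|` h y)%O.
Proof. by rewrite /h !bool_homU. Qed.
Let hC x : h (~` x)%O = (~` h x)%O. Proof. by rewrite /h !bool_homC. Qed.

Definition bool_comp : boolHom A C := BoolHom h0 h1 hI hU hC.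
End BoolComp.

Definition BA : category.
Proof.
refine (@Category boolAlg boolHom bool_id bool_comp _ _ _);
  by move=> *; exact: boolHomP.
Defined.

(* The library's algebras are nontrivial rings. Since the zero algebra is an
   object of the category of Specker algebras, a commutative R-algebra is
   presented as a possibly zero commutative ring S with a structure morphism
   from R to S; the scalar action of a on x is alg_str S a * x. *)
Record commAlg (R : comNzRingType) := CommAlg {
  alg_ring :> comPzRingType;
  alg_str : {rmorphism R -> alg_ring}
}.

Record algHom (R : comNzRingType) (S T : commAlg R) := AlgHom {
  alg_fun :> {rmorphism S -> T};
  alg_homC : forall a : R, alg_fun (alg_str S a) = alg_str T a
}.

Lemma algHomP (R : comNzRingType) (S T : commAlg R) (f g : algHom S T) :
  f =1 g -> f = g.
Proof.
case: f g => [f fC] [g gC] /= fg.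
suff E : f = g by rewrite -{}E in gC fg *; congr AlgHom; exact: Prop_irrelevance.
case: f g {fC gC} fg => [f [[f1] [f2]]] [g [[g1] [g2]]] /= /funext fg.
rewrite -{}fg in g1 g2 *.
by rewrite (Prop_irrelevance f1 g1) (Prop_irrelevance f2 g2).
Qed.

Definition alg_id (R : comNzRingType) (S : commAlg R) : algHom S S :=
  @AlgHom R S S idfun (fun _ => erefl).

Section AlgComp.
Variables (R : comNzRingType) (S T U : commAlg R).
Variables (g : algHom T U) (f : algHom S T).

Let gfC a : (g \o f) (alg_str S a) = alg_str U a.
Proof. by rewrite /= !alg_homC. Qed.

Definition alg_comp : algHom S U := @AlgHom R S U (g \o f) gfC.
End AlgComp.

Section Idempotents.
Variable S : comPzRingType.

Record idem : predArgType := Idem {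
  idem_val : S;
  idem_prop : idem_val * idem_val == idem_val
}.

HB.instance Definition _ := [isSub for idem_val].
HB.instance Definition _ := [Choice of idem by <:].

Implicit Types e f g : idem.

Lemma idemM e : val e * val e = val e. Proof. exact/eqP/idem_prop. Qed.

Fact idem0_subproof : (0 : S) * 0 == 0. Proof. by rewrite mul0r. Qed.
Definition idem0 := Idem idem0_subproof.

Fact idem1_subproof : (1 : S) * 1 == 1. Proof. by rewrite mul1r. Qed.
Definition idem1 := Idem idem1_subproof.

Fact idem_meet_subproof e f : (val e * val f) * (val e * val f) == val e * val f.
Proof. by rewrite mulrACA !idemM. Qed.
Definition idem_meet e f := Idem (idem_meet_subproof e f).

Fact idem_compl_subproof e : (1 - val e) * (1 - val e) == 1 - val e.
Proof. by rewrite mulrBr mulr1 mulrBl mul1r idemM subrr subr0. Qed.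
Definition idem_compl e := Idem (idem_compl_subproof e).

Fact idem_de_morgan e f :
  val e + val f - val e * val f = 1 - (1 - val e) * (1 - val f).
Proof.
rewrite mulrBr mulr1 mulrBl mul1r opprB opprB addrCA [1 + _]addrC subrK.
by rewrite addrC addrA.
Qed.

Fact idem_join_subproof e f :
  (val e + val f - val e * val f) * (val e + val f - val e * val f) ==
  val e + val f - val e * val f.
Proof.
rewrite idem_de_morgan.
exact: idem_prop (idem_compl (idem_meet (idem_compl e) (idem_compl f))).
Qed.
Definition idem_join e f := Idem (idem_join_subproof e f).

Definition idem_le e f := idem_meet e f == e.
Definition idem_lt e f := (f != e) && idem_le e f.

Fact idem_meetC : commutative idem_meet.
Proof. by move=> e f; apply/val_inj; rewrite /= mulrC. Qed.

Fact idem_joinC : commutative idem_join.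
Proof.
by move=> e f; apply/val_inj; congr (_ - _); [exact: addrC|exact: mulrC].
Qed.

Fact idem_meetA : associative idem_meet.
Proof. by move=> e f g; apply/val_inj; rewrite /= mulrA. Qed.

Fact idem_joinE e f :
  idem_join e f = idem_compl (idem_meet (idem_compl e) (idem_compl f)).
Proof. by apply/val_inj; rewrite /= -idem_de_morgan. Qed.

Fact idem_complK : involutive idem_compl.
Proof. by move=> e; apply/val_inj; rewrite /= opprB addrC subrK. Qed.

Fact idem_joinA : associative idem_join.
Proof. by move=> e f g; rewrite !idem_joinE !idem_complK idem_meetA. Qed.

Fact idem_joinKI f e : idem_meet e (idem_join e f) = e.
Proof.
by apply/val_inj; rewrite /= mulrBr mulrDr mulrA idemM addrK.
Qed.

Fact idem_meetKU f e : idem_join e (idem_meet e f) = e.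
Proof. by apply/val_inj; rewrite /= mulrA idemM addrK. Qed.

Fact idem_meetUl : left_distributive idem_meet idem_join.
Proof.
move=> e f g; apply/val_inj; rewrite /= mulrBl mulrDl; congr (_ - _).
by rewrite mulrACA idemM.
Qed.

Fact idem_meetxx : idempotent_op idem_meet.
Proof. by move=> e; apply/val_inj; rewrite /= idemM. Qed.

Fact idem_display : Order.disp_t. Proof. exact: Order.Disp tt tt. Qed.

HB.instance Definition _ := Order.isMeetJoinDistrLattice.Build idem_display idem
  (fun e f => erefl : idem_le e f = (idem_meet e f == e))
  (fun e f => erefl : idem_lt e f = (f != e) && idem_le e f)
  idem_meetC idem_joinC idem_meetA idem_joinA idem_joinKI idem_meetKU
  idem_meetUl idem_meetxx.

Fact idem_le0x e : (idem0 <= e)%O.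
Proof. by apply/eqP/val_inj; rewrite /= mul0r. Qed.

Fact idem_lex1 e : (e <= idem1)%O.
Proof. by apply/eqP/val_inj; rewrite /= mulr1. Qed.

HB.instance Definition _ := Order.hasBottom.Build idem_display idem idem_le0x.
HB.instance Definition _ := Order.hasTop.Build idem_display idem idem_lex1.

Fact idem_joinxC e : (e `|` idem_compl e)%O = \top%O.
Proof.
by apply/val_inj; rewrite /= mulrBr mulr1 idemM subrr subr0 addrC subrK.
Qed.

Fact idem_meetxC e : (e `&` idem_compl e)%O = \bot%O.
Proof. by apply/val_inj; rewrite /= mulrBr mulr1 idemM subrr. Qed.

HB.instance Definition _ := Order.TBDistrLattice_hasComplement.Build
  idem_display idem idem_joinxC idem_meetxC.

Lemma val_idemI e f : val (e `&` f)%O = val e * val f. Proof. by []. Qed.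
Lemma val_idemU e f : val (e `|` f)%O = val e + val f - val e * val f.
Proof. by []. Qed.
Lemma val_idemC e : val (~` e)%O = 1 - val e. Proof. by []. Qed.
Lemma val_idem0 : val (\bot%O : idem) = 0. Proof. by []. Qed.
Lemma val_idem1 : val (\top%O : idem) = 1. Proof. by []. Qed.
End Idempotents.

Definition idemBA (S : comPzRingType) : boolAlg :=
  @BoolAlg idem_display (idem S).

Section IdemMap.
Variables (S T : comPzRingType) (f : {rmorphism S -> T}).

Fact idem_map_subproof (e : idem S) : f (val e) * f (val e) == f (val e).
Proof. by rewrite -rmorphM idemM. Qed.

Definition idem_map (e : idem S) : idem T := Idem (idem_map_subproof e).

Fact idem_map0 : idem_map \bot%O = \bot%O.
Proof. by apply/val_inj; rewrite /= rmorph0. Qed.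
Fact idem_map1 : idem_map \top%O = \top%O.
Proof. by apply/val_inj; rewrite /= rmorph1. Qed.
Fact idem_mapI x y : idem_map (x `&` y)%O = (idem_map x `&` idem_map y)%O.
Proof. by apply/val_inj; rewrite /= rmorphM. Qed.
Fact idem_mapU x y : idem_map (x `|` y)%O = (idem_map x `|` idem_map y)%O.
Proof. by apply/val_inj; rewrite /= rmorphB rmorphD rmorphM. Qed.
Fact idem_mapC x : idem_map (~` x)%O = (~` idem_map x)%O.
Proof. by apply/val_inj; rewrite /= rmorphB rmorph1. Qed.

Definition idem_hom : boolHom (idemBA S) (idemBA T) :=
  @BoolHom (idemBA S) (idemBA T) idem_map
    idem_map0 idem_map1 idem_mapI idem_mapU idem_mapC.
End IdemMap.

Definition indecomposable (R : comNzRingType) : Prop :=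
  forall e : R, e * e = e -> e = 0 \/ e = 1.

Section Specker.
Variables (R : comNzRingType) (S : commAlg R).

Definition faithful (e : idem S) : Prop :=
  val e <> 0 /\ forall a : R, alg_str S a * val e = 0 -> a = 0.

Definition bool_subalg (B : idem S -> Prop) : Prop :=
  [/\ B \bot%O, B \top%O,
      forall e f, B e -> B f -> B (e `&` f)%O,
      forall e f, B e -> B f -> B (e `|` f)%O &
      forall e, B e -> B (~` e)%O].

Inductive alg_gen (B : idem S -> Prop) : S -> Prop :=
| alg_gen_in e : B e -> alg_gen B (val e)
| alg_gen_str a : alg_gen B (alg_str S a)
| alg_genD x y : alg_gen B x -> alg_gen B y -> alg_gen B (x + y)
| alg_genM x y : alg_gen B x -> alg_gen B y -> alg_gen B (x * y).

Definition faithful_generating (B : idem S -> Prop) : Prop :=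
  [/\ bool_subalg B,
      forall x : S, alg_gen B x &
      forall e, B e -> val e <> 0 -> faithful e].

Definition is_specker : Prop := exists B, faithful_generating B.
End Specker.

Record specker (R : comNzRingType) := SpeckerAlg {
  specker_alg :> commAlg R;
  specker_prop : is_specker specker_alg
}.

Definition Sp (R : comNzRingType) : category.
Proof.
refine (@Category (specker R) (fun S T => algHom S T)
  (fun S => alg_id S) (fun S T U g f => alg_comp g f) _ _ _);
  by move=> *; exact: algHomP.
Defined.

Definition functorI (R : comNzRingType) : functor (Sp R) BA.
Proof.
refine (@Functor (Sp R) BA (fun S : specker R => idemBA S)
  (fun (S T : specker R) (f : algHom S T) => idem_hom f) _ _).
- by move=> S; apply: boolHomP => e; exact: val_inj.
- by move=> S T U g f; apply: boolHomP => e; exact: val_inj.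
Defined.

(* ring_quotient only provides the ring structure for quotients by proper
   ideals. *)
Section GenQuotient.
Variables (A : comNzRingType) (G : A -> Prop).

Inductive ideal_gen : A -> Prop :=
| ideal_gen_in x : G x -> ideal_gen x
| ideal_gen0 : ideal_gen 0
| ideal_genD x y : ideal_gen x -> ideal_gen y -> ideal_gen (x + y)
| ideal_genM a x : ideal_gen x -> ideal_gen (a * x).

Definition ideal_pred : pred A := fun x => `[< ideal_gen x >].

Fact ideal_pred_zmod : zmod_closed ideal_pred.
Proof.
split; first exact/asboolP/ideal_gen0.
move=> x y /asboolP Ix /asboolP Iy; apply/asboolP/ideal_genD => //.
by rewrite -mulN1r; exact: ideal_genM.
Qed.

HB.instance Definition _ := GRing.isZmodClosed.Build A ideal_pred ideal_pred_zmod.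

Definition gen_quot := Quotient.quot (GRing.ZmodClosed.clone A ideal_pred _).

HB.instance Definition _ := GRing.Zmodule.on gen_quot.

Definition gq_pi (x : A) : gen_quot := (\pi_(gen_quot) x)%qT.

Lemma gq_piP x y : gq_pi x = gq_pi y <-> ideal_gen (x - y).
Proof.
have E : (x - y \in ideal_pred) = (gq_pi x == gq_pi y).
  exact: (Quotient.idealrBE (GRing.ZmodClosed.clone A ideal_pred _)).
split=> [/eqP|xy]; last apply/eqP; rewrite -E; last exact/asboolP.
by move/asboolP.
Qed.

Lemma gq_reprK (q : gen_quot) : gq_pi (repr q) = q.
Proof. exact: reprK. Qed.

Lemma gq_repr_ideal (x : A) : ideal_gen (repr (gq_pi x) - x).
Proof. by apply/gq_piP; rewrite gq_reprK. Qed.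

Fact gq_piB : zmod_morphism gq_pi.
Proof. exact: (raddfB (\pi_(gen_quot)%qT)). Qed.

HB.instance Definition _ := GRing.isZmodMorphism.Build A gen_quot gq_pi gq_piB.

Definition gq_one : gen_quot := gq_pi 1.
Definition gq_mul (p q : gen_quot) : gen_quot := gq_pi (repr p * repr q).

Fact gq_piM x y : gq_pi (x * y) = gq_mul (gq_pi x) (gq_pi y).
Proof.
apply/esym/gq_piP; set x' := repr _; set y' := repr _.
have -> : x' * y' - x * y = y' * (x' - x) + x * (y' - y).
  by rewrite !mulrBr [y' * x']mulrC [y' * x]mulrC addrA subrK.
by apply: ideal_genD; apply: ideal_genM; exact: gq_repr_ideal.
Qed.

Fact gq_mulA : associative gq_mul.
Proof.
move=> p q r; rewrite -(gq_reprK p) -(gq_reprK q) -(gq_reprK r).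
by rewrite -!gq_piM mulrA.
Qed.

Fact gq_mulC : commutative gq_mul.
Proof. by move=> p q; rewrite /gq_mul mulrC. Qed.

Fact gq_mul1 : left_id gq_one gq_mul.
Proof. by move=> p; rewrite -(gq_reprK p) -gq_piM mul1r. Qed.

Fact gq_mulDl : left_distributive gq_mul +%R.
Proof.
move=> p q r; rewrite -(gq_reprK p) -(gq_reprK q) -(gq_reprK r).
by rewrite -raddfD -!gq_piM mulrDl raddfD.
Qed.

HB.instance Definition _ := GRing.Zmodule_isComPzRing.Build gen_quot
  gq_mulA gq_mulC gq_mul1 gq_mulDl.

Fact gq_pi_monoid : monoid_morphism gq_pi.
Proof. by split=> // x y; exact: gq_piM. Qed.

HB.instance Definition _ :=
  GRing.isMonoidMorphism.Build A gen_quot gq_pi gq_pi_monoid.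

Lemma gq_pi_0 : gq_pi 0 = 0. Proof. exact: rmorph0. Qed.

Lemma gq_pi_compl x : gq_pi (1 - x) = 1 - gq_pi x.
Proof. by rewrite rmorphB rmorph1. Qed.

Section Lift.
Variables (T : comPzRingType) (f : {rmorphism A -> T}).
Hypothesis fG : forall x, G x -> f x = 0.

Definition gq_lift of (forall x, G x -> f x = 0) :=
  fun q : gen_quot => f (repr q).

Fact ideal_gen_ker x : ideal_gen x -> f x = 0.
Proof.
elim=> {x} [x /fG //||x y _ fx _ fy|a x _ fx]; first exact: rmorph0.
  by rewrite rmorphD fx fy addr0.
by rewrite rmorphM fx mulr0.
Qed.

Lemma gq_lift_pi x : gq_lift fG (gq_pi x) = f x.
Proof.
apply/eqP; rewrite -subr_eq0 -rmorphB; apply/eqP/ideal_gen_ker.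
exact: gq_repr_ideal.
Qed.

Fact gq_liftB : zmod_morphism (gq_lift fG).
Proof.
move=> p q; rewrite -(gq_reprK p) -(gq_reprK q).
by rewrite -raddfB !gq_lift_pi rmorphB.
Qed.

Fact gq_liftM : monoid_morphism (gq_lift fG).
Proof.
split; first by rewrite (gq_lift_pi 1) rmorph1.
move=> p q; rewrite -(gq_reprK p) -(gq_reprK q).
by rewrite -rmorphM !gq_lift_pi rmorphM.
Qed.

HB.instance Definition _ :=
  GRing.isZmodMorphism.Build gen_quot T (gq_lift fG) gq_liftB.
HB.instance Definition _ :=
  GRing.isMonoidMorphism.Build gen_quot T (gq_lift fG) gq_liftM.
End Lift.
End GenQuotient.

Arguments gq_pi {A} G x.
Arguments gq_lift {A G T} f fG q : rename.

Section PolyEval.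
Variables (I : choiceType) (A : comNzRingType).

Lemma malg_poly_ind (P : {malg A[{cmonom I}]} -> Prop) :
  (forall a, P a%:MP) -> (forall i, P << ucm i >>) ->
  (forall p q, P p -> P q -> P (p + q)) ->
  (forall p q, P p -> P q -> P (p * q)) -> forall p, P p.
Proof.
move=> PC PX PD PM p.
have P0 : P 0 by rewrite -(rmorph0 (@malgC {cmonom I} A)); exact: PC.
have PU (m : {cmonom I}) : P << m >>.
  have [n] := ubnP (mdeg m); elim: n m => // n IHn m lt_m.
  have [m0|[i mi]] := fset_0Vmem (finsupp m).
    suff -> : m = mone by exact: PC.
    by apply: mdeg_eq0I; rewrite /mdeg m0 big_seq_fset0.
  have Em : m = mmul (ucm i) (divcm m (ucm i)).
    apply/eqP/cmP => j; rewrite cmM divcmE cmU.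
    case: eqVneq => [<-|_]; last by rewrite subn0.
    by rewrite subnKC // lt0n cmE_neq0.
  rewrite Em -[<< _ >>](_ : << ucm i >> * << divcm m (ucm i) >> = _).
    apply: PM => //; apply: IHn; move: lt_m.
    by rewrite {1}Em mdegM mdegU.
  by rewrite malgM_def fgmulUU mulr1.
rewrite (monalgE p).
elim/big_rec: _ => [//|m q _ Pq]; apply: PD => //.
rewrite -[<< _ *g m >>](_ : (p@_m)%:MP * << m >> = _); first exact: PM.
by rewrite malgM_def fgmulUU mulr1 mul1m.
Qed.

Variables (T : comNzRingType) (f : {rmorphism A -> T}) (v : I -> T).

Definition cmeval (m : {cmonom I}) : T := \prod_(i <- finsupp m) v i ^+ m i.

Lemma cmevalEw (d : {fset I}) (m : {cmonom I}) :
  (finsupp m `<=` d)%fset -> cmeval m = \prod_(i <- d) v i ^+ m i.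
Proof.
move=> le_md; apply: big_fset_incl => // i _.
by rewrite memNfinsupp => /eqP ->; rewrite expr0.
Qed.

Fact cmeval_mmorphism : mmorphism cmeval.
Proof.
split=> [m1 m2|]; last first.
  by rewrite /cmeval mdom1 big_seq_fset0.
rewrite [LHS](@cmevalEw (finsupp m1 `|` finsupp m2)%fset) ?mdomD //.
rewrite (@cmevalEw (finsupp m1 `|` finsupp m2)%fset m1) ?fsubsetUl //.
rewrite (@cmevalEw (finsupp m1 `|` finsupp m2)%fset m2) ?fsubsetUr //.
by rewrite -big_split; apply: eq_bigr => i _; rewrite cmM exprD.
Qed.

HB.instance Definition _ :=
  isMultiplicative.Build {cmonom I} T cmeval cmeval_mmorphism.

Definition peval : {rmorphism {malg A[{cmonom I}]} -> T} := mmap f cmeval.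

Lemma pevalC a : peval a%:MP = f a.
Proof. exact: mmapC. Qed.

Lemma pevalX i : peval << ucm i >> = v i.
Proof.
rewrite [LHS]mmapU [X in X * _](rmorph1 f) mul1r /= /cmeval mdomU big_seq_fset1.
by rewrite cmUU expr1.
Qed.
End PolyEval.

(* {malg R[{cmonom B}]} is the polynomial ring in variables indexed by B, and
   << ucm e >> is the variable x_e; it is locked because comparing two distinct
   variables up to conversion is very slow. *)
HB.lock Definition bvar (R : comNzRingType) (B : boolAlg) (e : B) :
  {malg R[{cmonom B}]} := << ucm e >>.

Section SpeckerOf.
Variables (R : comNzRingType) (B : boolAlg).

Local Notation poly := {malg R[{cmonom B}]}.

Local Notation bvar := (bvar R).

Inductive bool_rel : poly -> Prop :=
| bool_relI e f : bool_rel (bvar (e `&` f)%O - bvar e * bvar f)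
| bool_relU e f :
    bool_rel (bvar (e `|` f)%O - (bvar e + bvar f - bvar e * bvar f))
| bool_relC e : bool_rel (bvar (~` e)%O - (1 - bvar e))
| bool_rel0 : bool_rel (bvar \bot%O).

Definition bool_ring : comPzRingType := gen_quot bool_rel.

Definition bool_algebra : commAlg R :=
  @CommAlg R bool_ring (gq_pi bool_rel \o @malgC {cmonom B} R).

Definition yvar (e : B) : bool_algebra := gq_pi bool_rel (bvar e).

Lemma yvarI e f : yvar (e `&` f)%O = yvar e * yvar f.
Proof.
by rewrite /yvar -rmorphM; apply/gq_piP/ideal_gen_in; exact: bool_relI.
Qed.

Lemma yvarU e f : yvar (e `|` f)%O = yvar e + yvar f - yvar e * yvar f.
Proof.
rewrite /yvar -rmorphM -rmorphD -rmorphB.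
by apply/gq_piP/ideal_gen_in; exact: bool_relU.
Qed.

Lemma yvarC e : yvar (~` e)%O = 1 - yvar e.
Proof.
rewrite /yvar -gq_pi_compl.
by apply/gq_piP/ideal_gen_in; exact: bool_relC.
Qed.

Lemma yvar0 : yvar \bot%O = 0.
Proof.
rewrite /yvar -(gq_pi_0 bool_rel).
by apply/gq_piP; rewrite subr0; apply/ideal_gen_in; exact: bool_rel0.
Qed.

Lemma yvar1 : yvar \top%O = 1.
Proof. by rewrite -compl0 yvarC yvar0 subr0. Qed.

Lemma bool_algebra_ind (P : bool_algebra -> Prop) :
  (forall a, P (alg_str bool_algebra a)) -> (forall e, P (yvar e)) ->
  (forall p q, P p -> P q -> P (p + q)) ->
  (forall p q, P p -> P q -> P (p * q)) -> forall p, P p.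
Proof.
move=> PC PX PD PM p; rewrite -(gq_reprK p).
elim/malg_poly_ind: (repr p) => [//|e|x y|x y].
- have <- : bvar e = << ucm e >> by rewrite bvar.unlock.
  exact: PX.
- by rewrite rmorphD; exact: PD.
- by rewrite rmorphM; exact: PM.
Qed.

Section Lift.
Variables (T : comPzRingType) (f : {rmorphism poly -> T}) (v : B -> T).
Hypotheses (fv : forall e, f (bvar e) = v e)
  (vI : forall e e', v (e `&` e')%O = v e * v e')
  (vU : forall e e', v (e `|` e')%O = v e + v e' - v e * v e')
  (vC : forall e, v (~` e)%O = 1 - v e) (v0 : v \bot%O = 0).

Lemma bool_rel_ker x : bool_rel x -> f x = 0.
Proof.
case=> [e e'|e e'|e|].
- by rewrite (rmorphB f) fv (rmorphM f) !fv vI subrr.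
- by rewrite (rmorphB f) fv (rmorphB f) (rmorphD f) !fv (rmorphM f) !fv vU subrr.
- by rewrite (rmorphB f) fv (rmorphB f) fv (rmorph1 f) vC subrr.
- by rewrite fv.
Qed.
End Lift.

Lemma ultrafilter_exists (e : B) : e != \bot%O ->
  exists U : B -> bool, [/\ U e, U \bot%O = false,
    forall x y, U (x `&` y)%O = U x && U y,
    forall x y, U (x `|` y)%O = U x || U y &
    forall x, U (~` x)%O = ~~ U x].
Proof.
move=> e_n0.
pose meets (s : seq B) := foldr (fun x y => x `&` y)%O e s.
have meets_cat s t : meets (s ++ t) = (meets s `&` meets t)%O.
  elim: s => [|x s IHs] /=; last by rewrite IHs meetA.
  by elim: t => [|x t IHt] /=; rewrite ?meetxx // {1}IHt meetCA.
pose fip (F : set B) :=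
  forall s : seq B, (forall x, x \in s -> F x) -> meets s != \bot%O.
have [F chF totF|U [fipU maxU]] := @Zorn_bigcup B fip.
  move=> s sF.
  have [[x Fx]|F0] := pselect (exists X, F X); last first.
    by case: s sF => [|x s] // /(_ x (mem_head _ _)) [X FX]; case: F0; exists X.
  suff [X FX sX] : exists2 X, F X & forall x, x \in s -> X x by exact: (chF X).
  elim: s sF => [|y s IHs] sF; first by exists x.
  have [z zs|X FX sX] := IHs; first by apply: sF; rewrite inE zs orbT.
  have [Y FY Yy] := sF y (mem_head _ _).
  have [XY|YX] := totF _ _ FX FY.
    by exists Y => // z; rewrite inE => /orP[/eqP->|/sX/XY].
  by exists X => // z; rewrite inE => /orP[/eqP->|/sX //]; exact: YX.
have U_ext x : (forall s, (forall y, y \in s -> U y) ->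
    (x `&` meets s)%O != \bot%O) -> U x.
  move=> xP; apply: contrapT => nUx.
  apply: (maxU (fun y => U y \/ y = x)).
    by split=> [y Uy|sub]; [left|apply: nUx; apply: sub; right].
  move=> s sU.
  have sU' y : y \in [seq y <- s | y != x] -> U y.
    by rewrite mem_filter => /andP[/eqP nyx /sU []].
  apply: contra_neq (xP _ sU'); move=> s0; apply/eqP; rewrite -lex0 -s0.
  elim: {sU sU' s0} s => [|y s IHs] /=; first exact: leIr.
  case: eqVneq => [->|_] /=; first by rewrite lexI leIl.
  by rewrite meetCA leI2.
have nUU x : U x -> U (~` x)%O -> False.
  move=> Ux Uc.
  have Us y : y \in [:: x; (~` x)%O] -> U y.
    by rewrite !inE => /orP[/eqP->|/eqP->].
  by have /= := fipU _ Us; rewrite meetA meetxC meet0x eqxx.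
have U_up x s : (forall y, y \in s -> U y) -> (meets s <= x)%O -> U x.
  move=> sU lex; apply: U_ext => t tU.
  have : meets (s ++ t) != \bot%O.
    by apply: fipU => y; rewrite mem_cat => /orP[/sU|/tU].
  apply: contra_neq => xt0; apply/eqP; rewrite -lex0 -xt0 meets_cat.
  exact: leI2.
have U_dec x : ~ U x -> U (~` x)%O.
  move=> nUx; apply: U_ext => s sU; apply/eqP => xs0; apply: nUx.
  apply: (U_up x s) => //.
  by rewrite -[x]complK -disj_leC meetC xs0.
exists (fun x => `[< U x >]).
have Ubot : ~ U \bot%O.
  move=> U0; have Us y : y \in [:: (\bot : B)%O] -> U y by rewrite inE => /eqP->.
  by have /= := fipU _ Us; rewrite meet0x eqxx.
have UI x y : U (x `&` y)%O <-> U x /\ U y.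
  split=> [Uxy|[Ux Uy]].
    have Us z : z \in [:: (x `&` y)%O] -> U z by rewrite inE => /eqP->.
    by split; apply: (U_up _ _ Us); rewrite /= -meetA ?leIl // meetCA leIl.
  apply: (U_up _ [:: x; y]) => [z|/=]; last by rewrite meetA leIl.
  by rewrite !inE => /orP[/eqP->|/eqP->].
have UC x : U (~` x)%O <-> ~ U x.
  by split=> [Uc Ux|/U_dec //]; exact: nUU Ux Uc.
split.
- by apply/asboolP/(U_up _ [::]).
- exact/asboolP.
- by move=> x y; rewrite -asbool_and; apply: asbool_equiv_eq.
- move=> x y; rewrite -asbool_or; apply: asbool_equiv_eq.
  rewrite -[(x `|` y)%O]complK complU UC UI !UC.
  split=> [nxy|xy [nx ny]]; last by case: xy.
  by have [Ux|nUx] := pselect (U x); [left|right; apply: contrapT => nUy; apply: nxy].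
- by move=> x; rewrite -asbool_neg; apply: asbool_equiv_eq.
Qed.

Lemma yvar_neq0_faithful (e : B) (a : R) :
  e != \bot%O -> alg_str bool_algebra a * yvar e = 0 -> a = 0.
Proof.
move=> /ultrafilter_exists [U [Ue U0 UI UU UC]] ae0.
pose v (x : B) : R := if U x then 1 else 0.
pose ev := @peval B R R idfun v.
have evX x : ev (bvar x) = v x by rewrite bvar.unlock; exact: pevalX.
have ker : forall x, bool_rel x -> ev x = 0.
  apply: (@bool_rel_ker _ ev v evX) => [x y|x y|x|]; rewrite /v ?UI ?UU ?UC ?U0 //.
  - by case: (U x); rewrite ?mul1r ?mul0r.
  - by case: (U x); case: (U y);
      rewrite /= !(mul0r, mul1r, mulr0, addrK, oppr0, addr0, add0r).
  - by case: (U x); rewrite /= ?subrr ?subr0.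
have := congr1 (gq_lift ev ker) ae0.
rewrite (rmorphM (gq_lift ev ker)) (rmorph0 (gq_lift ev ker)).
rewrite [X in X * _]gq_lift_pi [X in _ * X]gq_lift_pi evX /v Ue mulr1 => <-.
by rewrite [RHS]pevalC.
Qed.

Fact yvar_idem (e : B) : yvar e * yvar e == yvar e.
Proof. by rewrite -yvarI meetxx. Qed.

Definition yidem (e : B) : idem bool_algebra := Idem (yvar_idem e).

Lemma bool_algebra_specker : is_specker bool_algebra.
Proof.
exists (fun i => exists e, i = yidem e); split.
- split.
  + by exists \bot%O; apply/val_inj; rewrite /= yvar0.
  + by exists \top%O; apply/val_inj; rewrite /= yvar1.
  + by move=> _ _ [e ->] [f ->]; exists (e `&` f)%O; apply/val_inj; rewrite /= yvarI.
  + by move=> _ _ [e ->] [f ->]; exists (e `|` f)%O; apply/val_inj; rewrite /= yvarU.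
  + by move=> _ [e ->]; exists (~` e)%O; apply/val_inj; rewrite /= yvarC.
- elim/bool_algebra_ind => [a|e|p q|p q].
  + exact: alg_gen_str.
  + by apply: (@alg_gen_in _ _ _ (yidem e)); exists e.
  + exact: alg_genD.
  + exact: alg_genM.
- move=> _ [e ->] /= ye0; split=> // a; apply: yvar_neq0_faithful.
  by apply/eqP => e0; apply: ye0; rewrite e0 yvar0.
Qed.

Definition bool_specker : specker R := SpeckerAlg bool_algebra_specker.

Lemma bool_algebra_homP (S : commAlg R) (f g : algHom bool_algebra S) :
  (forall e, f (yvar e) = g (yvar e)) -> f = g.
Proof.
move=> fg; apply: algHomP; elim/bool_algebra_ind => [a|e|p q fp fq|p q fp fq].
- by rewrite !alg_homC.
- exact: fg.
- by rewrite (rmorphD f) (rmorphD g) fp fq.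
- by rewrite (rmorphM f) (rmorphM g) fp fq.
Qed.
End SpeckerOf.

Section SpeckerMap.
Variables (R : comNzRingType) (B C : boolAlg) (s : boolHom B C).

Definition bool_algebra_map_poly :
    {rmorphism {malg R[{cmonom B}]} -> bool_algebra R C} :=
  gq_pi (@bool_rel R C) \o peval (@malgC {cmonom C} R) (fun e => bvar R (s e)).

Lemma bool_algebra_map_polyX e : bool_algebra_map_poly (bvar R e) = yvar R (s e).
Proof.
rewrite /bool_algebra_map_poly /= /yvar; congr (gq_pi _ _).
have -> : bvar R e = << ucm e >> by rewrite bvar.unlock.
exact: pevalX.
Qed.

Lemma bool_algebra_map_ker x : bool_rel x -> bool_algebra_map_poly x = 0.
Proof.
apply: (bool_rel_ker bool_algebra_map_polyX) => [e f|e f|e|].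
- by rewrite bool_homI yvarI.
- by rewrite bool_homU yvarU.
- by rewrite bool_homC yvarC.
- by rewrite bool_hom0 yvar0.
Qed.

Fact bool_algebra_map_str (a : R) :
  gq_lift bool_algebra_map_poly bool_algebra_map_ker (alg_str (bool_algebra R B) a) =
  alg_str (bool_algebra R C) a.
Proof. by rewrite [LHS]gq_lift_pi; congr (gq_pi _ _); exact: pevalC. Qed.

Definition bool_algebra_map : algHom (bool_algebra R B) (bool_algebra R C) :=
  @AlgHom R (bool_algebra R B) (bool_algebra R C)
    (gq_lift bool_algebra_map_poly bool_algebra_map_ker) bool_algebra_map_str.

Lemma bool_algebra_mapE (e : B) : bool_algebra_map (yvar R e) = yvar R (s e).
Proof. by rewrite [LHS]gq_lift_pi bool_algebra_map_polyX. Qed.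
End SpeckerMap.

Definition functorS (R : comNzRingType) : functor BA (Sp R).
Proof.
refine (@Functor BA (Sp R) (fun B : boolAlg => bool_specker R B)
  (fun (B C : boolAlg) (s : boolHom B C) => bool_algebra_map R s) _ _).
- by move=> B; apply: bool_algebra_homP => e; exact: bool_algebra_mapE.
- move=> B C D t s; apply: bool_algebra_homP => e.
  transitivity (yvar R (t (s e))); first exact: bool_algebra_mapE.
  by rewrite -(bool_algebra_mapE R t) -(bool_algebra_mapE R s).
Defined.

(* Main.v *)
Require Import Defs.
From mathcomp Require Import all_boot all_order all_algebra.
From HB Require Import structures.
From mathcomp Require Import boolp monalg.

(* The unit e |-> y_e is always an injective Boolean homomorphism B -> Id(R[B])
   and the counit R[Id(S)] -> S, y_e |-> e, is always surjective. An element x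
   of an algebra generated by a Boolean algebra B of idempotents satisfies
   x e = a e, with scalars a depending on e, for finitely many e in B whose join
   is 1. If x is idempotent and e faithful, then a is idempotent, so over an
   indecomposable R the product x e is 0 or e and x itself lies in B. Hence the
   unit is onto and Id(S) is the only faithful generating algebra of S; if the
   counit kills x then all a e vanish, so the counit is injective.
   Conversely, with 2 = {0, 1}, every element of R[2] is a scalar. An
   isomorphism between 2 and Id(R[2]) leaves only the idempotents 0 and 1 in R.
   If R[Id(R[2])] and R[2] are isomorphic, then each y_e with e an idempotent of
   R[2] is a scalar r; were e different from 0 and 1, y_e and y_{~e} would be
   faithful, and r y_{~e} = 0 would give r = 0, hence y_e = 0. *)

Set Implicit Arguments.
Unset Strict Implicit.
Unset Printing Implicit Defensive.

Import Order.TTheory Order.CTheory GRing.Theory.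

Local Open Scope ring_scope.

(** * Inverses of natural isomorphisms and of bijective homomorphisms *)

Lemma bijective_of (T U : Type) (f : T -> U) :
  injective f -> (forall y, exists x, f x = y) ->
  exists2 g : U -> T, cancel f g & cancel g f.
Proof.
move=> f_inj f_surj; pose g y := sval (cid (f_surj y)).
have gK : cancel g f by move=> y; exact: svalP (cid (f_surj y)).
by exists g => // x; apply: f_inj; rewrite gK.
Qed.

Lemma nat_iso_sym (C D : category) (F G : functor C D) :
  nat_iso F G -> nat_iso G F.
Proof.
case=> eta [eta_nat eta_iso'].
have eta_iso X := cid (eta_iso' X).
pose inv X := sval (eta_iso X).
have invK X : Defs.comp (inv X) (eta X) = idm _ by case: (svalP (eta_iso X)).
have Kinv X : Defs.comp (eta X) (inv X) = idm _ by case: (svalP (eta_iso X)).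
exists inv; split=> [X Y f|X]; last by exists (eta X).
rewrite -[fmor G f]compfid -(Kinv X) [Defs.comp (fmor G f) _]compfA -eta_nat.
by rewrite !compfA invK compidf.
Qed.

Lemma bool_iso (A B : boolAlg) (f : boolHom A B) :
  injective f -> (forall y, exists x, f x = y) -> @is_iso BA A B f.
Proof.
move=> f_inj /(bijective_of f_inj)[g fK gK].
have g0 : g \bot%O = \bot%O by rewrite -(bool_hom0 f) fK.
have g1 : g \top%O = \top%O by rewrite -(bool_hom1 f) fK.
have gI x y : g (x `&` y)%O = (g x `&` g y)%O.
  by apply: f_inj; rewrite bool_homI !gK.
have gU x y : g (x `|` y)%O = (g x `|` g y)%O.
  by apply: f_inj; rewrite bool_homU !gK.
have gC x : g (~` x)%O = (~` g x)%O by apply: f_inj; rewrite bool_homC !gK.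
by exists (BoolHom g0 g1 gI gU gC); split; apply: boolHomP.
Qed.

Lemma alg_iso (R : comNzRingType) (S T : specker R) (f : algHom S T) :
  injective f -> (forall y, exists x, f x = y) -> @is_iso (Sp R) S T f.
Proof.
move=> f_inj /(bijective_of f_inj)[g fK gK].
pose gz := GRing.isZmodMorphism.Build T S g (can2_zmod_morphism fK gK).
pose gm := GRing.isMonoidMorphism.Build T S g (can2_monoid_morphism fK gK).
pose gr : {rmorphism T -> S} := HB.pack g gz gm.
have gC a : gr (alg_str T a) = alg_str S a by rewrite -(alg_homC f) /= fK.
by exists (AlgHom gC); split; apply: algHomP.
Qed.

(** * Algebras generated by a Boolean algebra of idempotents *)

Lemma mulr_idem_le (S : comPzRingType) (x a : S) (e f : idem S) :
  (f <= e)%O -> x * val e = a * val e -> x * val f = a * val f.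
Proof. by move=> /eqP <- xe; rewrite val_idemI mulrCA xe mulrCA. Qed.

Section Generation.
Variables (R : comNzRingType) (S : commAlg R) (B : idem S -> Prop).

(* An element of the algebra generated by [B] is constant on each piece of a
   finite cover taken in [B]; quantifying over join-stable properties [P]
   replaces the bookkeeping of covers and of their common refinements. *)
Lemma alg_gen_local (x : S) (P : idem S -> Prop) : bool_subalg B ->
  (forall e f, P e -> P f -> P (e `|` f)%O) -> alg_gen B x ->
  forall d, B d ->
  (forall e a, B e -> (e <= d)%O ->
     x * val e = alg_str S a * val e -> P e) -> P d.
Proof.
move=> [_ _ BI _ BC] PU.
elim=> {x} [g Bg|a|x y _ IHx _ IHy|x y _ IHx _ IHy] d Bd dP.
(* The generator [g] acts as 1 below itself and as 0 below its complement. *)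
- have -> : d = ((d `&` g) `|` (d `&` ~` g))%O by rewrite -meetUr joinxC meetx1.
  apply: PU.
  + apply: (dP _ 1); [exact: BI|exact: leIl|].
    by rewrite rmorph1 mul1r mulrCA idemM.
  + apply: (dP _ 0); [by apply: BI => //; exact: BC|exact: leIl|].
    by rewrite rmorph0 mul0r mulrCA mulrBr mulr1 idemM subrr mulr0.
- exact: (dP d a).
(* The pieces for [x] are refined by those for [y]. *)
- apply: IHx Bd _ => e a Be le_ed xe; apply: IHy Be _ => f b Bf le_fe yf.
  apply: (dP f (a + b)) => //; first exact: le_trans le_ed.
  by rewrite rmorphD !mulrDl yf (mulr_idem_le le_fe xe).
- apply: IHx Bd _ => e a Be le_ed xe; apply: IHy Be _ => f b Bf le_fe yf.
  apply: (dP f (a * b)) => //; first exact: le_trans le_ed.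
  by rewrite rmorphM -!mulrA yf mulrCA (mulr_idem_le le_fe xe) mulrCA.
Qed.

Lemma specker_idem : indecomposable R -> faithful_generating B ->
  forall e, B e.
Proof.
move=> Rind [subB genB faithB] x; have [B0 B1 BI BU BC] := subB.
(* The claim becomes the case of the top element in a join-stable property of [d]. *)
rewrite -[x]meetx1.
apply: (@alg_gen_local (val x) (fun d => B (x `&` d)%O) subB _ (genB _)) => //.
  by move=> e f Be Bf; rewrite meetUr; exact: BU.
move=> e a Be _ xe.
have [e0|/(faithB _ Be)[_ faith_e]] := pselect (val e = 0).
  suff -> : (x `&` e)%O = \bot%O by [].
  by apply: val_inj; rewrite val_idemI e0 mulr0.
(* As [x] is idempotent, [a * a] and [a] both act on [e] as [x] does, and [e] is faithful. *)
have /Rind[a0|a1] : a * a = a.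
- apply/eqP; rewrite -subr_eq0; apply/eqP/faith_e.
  by rewrite rmorphB rmorphM mulrBl -mulrA -xe mulrCA -xe mulrA idemM subrr.
- suff -> : (x `&` e)%O = \bot%O by [].
  by apply: val_inj; rewrite val_idemI xe a0 rmorph0 mul0r.
- suff -> : (x `&` e)%O = e by [].
  by apply: val_inj; rewrite val_idemI xe a1 rmorph1 mul1r.
Qed.

End Generation.

(** * The algebra R[B]: canonical idempotents and universal property *)

Section BoolAlgebra.
Variables (R : comNzRingType) (B : boolAlg).

Let Y (i : idem (bool_algebra R B)) := exists e, i = yidem R e.

Lemma yidem_subalg : bool_subalg Y.
Proof.
split.
- by exists \bot%O; apply/val_inj; rewrite /= yvar0.
- by exists \top%O; apply/val_inj; rewrite /= yvar1.
- move=> _ _ [e ->] [f ->]; exists (e `&` f)%O.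
  by apply/val_inj; rewrite /= yvarI.
- move=> _ _ [e ->] [f ->]; exists (e `|` f)%O.
  by apply/val_inj; rewrite /= yvarU.
- by move=> _ [e ->]; exists (~` e)%O; apply/val_inj; rewrite /= yvarC.
Qed.

Lemma yidem_gen x : alg_gen Y x.
Proof.
elim/bool_algebra_ind: x => [a|e|p q|p q].
- exact: alg_gen_str.
- by apply: (@alg_gen_in _ _ _ (yidem R e)); exists e.
- exact: alg_genD.
- exact: alg_genM.
Qed.

Lemma yidem_faithful_generating : faithful_generating Y.
Proof.
split; [exact: yidem_subalg|exact: yidem_gen|].
move=> _ [e ->] /= ye0; split=> // a; apply: yvar_neq0_faithful.
by apply/eqP => e0; apply: ye0; rewrite e0 yvar0.
Qed.

(** For nonzero [e], faithfulness prevents the scalar 1 from killing [yvar R e]. *)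
Lemma yvar_eq0 (e : B) : yvar R e = 0 -> e = \bot%O.
Proof.
move=> ye0; apply: contrapT => /eqP/(@yvar_neq0_faithful R _ _ 1).
by rewrite ye0 mulr0 => /(_ erefl)/eqP; rewrite oner_eq0.
Qed.

(** When [e] and [f] have equal images, the meet of [e] with the complement of [f] is sent to 0,
    hence is bottom. *)
Lemma yidem_inj : injective (@yidem R B).
Proof.
suff le (e f : B) : yidem R e = yidem R f -> (e <= f)%O.
  by move=> e f ef; apply: le_anti; rewrite !le.
move=> /(congr1 val) /= ef.
rewrite -[f]complK -disj_leC; apply/eqP/yvar_eq0.
by rewrite yvarI yvarC ef mulrBr mulr1 -yvarI meetxx subrr.
Qed.

Definition yhom : boolHom B (idemBA (bool_algebra R B)).
Proof.
apply: (@BoolHom B (idemBA (bool_algebra R B)) (@yidem R B)) => *;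
  apply: val_inj; rewrite /=;
  [exact: yvar0|exact: yvar1|exact: yvarI|exact: yvarU|exact: yvarC].
Defined.

(** The universal property of R[B]; lifting an identity gives the counit. *)
Lemma bool_algebra_lift (T : commAlg R) (v : boolHom B (idemBA T)) :
  exists f : algHom (bool_algebra R B) T, forall e, f (yvar R e) = val (v e).
Proof.
(* Polynomials evaluate only in nontrivial rings, and T may be zero. *)
have [T0|/eqP T1] := pselect (1 = 0 :> T).
  have T_eq x y : x = y :> T by rewrite -[x]mulr1 -[y]mulr1 T0 !mulr0.
  pose f (_ : bool_algebra R B) : T := 0.
  have f0 : zmod_morphism f by move=> x y; exact: T_eq.
  have f1 : monoid_morphism f by split=> [|x y]; exact: T_eq.
  pose fz := GRing.isZmodMorphism.Build _ _ _ f0.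
  pose fm := GRing.isMonoidMorphism.Build _ _ _ f1.
  pose fr : {rmorphism bool_algebra R B -> T} := HB.pack f fz fm.
  by exists (@AlgHom R (bool_algebra R B) T fr (fun a => T_eq _ _)).
pose nzT := GRing.PzSemiRing_isNonZero.Build T T1.
pose T' : comNzRingType := HB.pack (alg_ring T) nzT.
pose w e : T' := val (v e).
pose f : {rmorphism {malg R[{cmonom B}]} -> T} :=
  @peval B R T' (alg_str T) w.
have fX e : f (bvar R e) = val (v e).
  by rewrite bvar.unlock; exact: (@pevalX B R T' (alg_str T) w e).
have f_ker : forall x, bool_rel x -> f x = 0.
  apply: (bool_rel_ker fX) => [d e|d e|e|].
  - by rewrite bool_homI.
  - by rewrite bool_homU.
  - by rewrite bool_homC.
  - by rewrite bool_hom0.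
have fC a : gq_lift f f_ker (alg_str (bool_algebra R B) a) = alg_str T a.
  by rewrite [LHS]gq_lift_pi; exact: (@pevalC B R T' (alg_str T) w a).
exists (@AlgHom R (bool_algebra R B) T (gq_lift f f_ker) fC) => e.
by rewrite [LHS]gq_lift_pi fX.
Qed.

End BoolAlgebra.

(** * The counit R[Id(S)] -> S *)

Definition counit (R : comNzRingType) (S : commAlg R) :
  algHom (bool_algebra R (idemBA S)) S :=
  sval (cid (bool_algebra_lift (bool_id (idemBA S)))).

Lemma counitE (R : comNzRingType) (S : commAlg R) (e : idem S) :
  counit S (yvar R (e : idemBA S)) = val e.
Proof. exact: svalP (cid (bool_algebra_lift (bool_id (idemBA S)))) e. Qed.

Lemma counit_surj (R : comNzRingType) (S : specker R) (x : S) :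
  exists p, counit S p = x.
Proof.
have [B [_ gen _]] := specker_prop S.
elim: (gen x) => {x} [e _|a|x y _ [p <-] _ [q <-]|x y _ [p <-] _ [q <-]].
- by exists (yvar R (e : idemBA S)); exact: counitE.
- by exists (alg_str _ a); exact: alg_homC.
- by exists (p + q); exact: rmorphD.
- by exists (p * q); exact: rmorphM.
Qed.

(** * Unit and counit over an indecomposable ring *)

Section Indecomposable.
Variables (R : comNzRingType) (Rind : indecomposable R).

Lemma yidem_surj (B : boolAlg) (x : idem (bool_algebra R B)) :
  exists e, yidem R e = x.
Proof.
by have [e ->] := specker_idem Rind (yidem_faithful_generating R B) x; exists e.
Qed.

Lemma counit_inj (S : specker R) : injective (counit S).
Proof.
(* Here [B] is all of Id(S), so every nonzero idempotent of [S] is faithful. *)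
have [B fgB] := specker_prop S; have BT := specker_idem Rind fgB.
have faith (e : idem S) : val e <> 0 -> faithful e.
  by case: fgB => _ _ /(_ e (BT e)).
suff ker0 x : counit S x = 0 -> x = 0.
  move=> x y xy; apply/eqP; rewrite -subr_eq0; apply/eqP/ker0.
  by rewrite rmorphB xy subrr.
move=> x0; rewrite -[x]mulr1.
have [_ Y1 _ _ _] := yidem_subalg R (idemBA S).
apply: (alg_gen_local (P := fun e => x * val e = 0)
  (yidem_subalg R (idemBA S)) _ (yidem_gen x) Y1) => [e f xe xf|].
  by rewrite val_idemU mulrBr mulrDr mulrA xe xf mul0r addr0 subr0.
move=> _ a [e ->] _ xe.
have /esym ae0 : 0 = alg_str S a * val e.
  rewrite -(alg_homC (counit S)) -counitE -(rmorphM (counit S)) -xe.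
  by rewrite (rmorphM (counit S)) x0 mul0r.
rewrite xe.
have [e0|/faith[_ /(_ a ae0) ->]] := pselect (val e = 0).
  have -> : e = \bot%O by exact: val_inj.
  by rewrite /= yvar0 mulr0.
by rewrite rmorph0 mul0r.
Qed.

Lemma yhom_nat_iso :
  nat_iso (id_functor BA) (comp_functor (functorI R) (functorS R)).
Proof.
exists (@yhom R); split=> [A B s|B].
  by apply: boolHomP => e; apply: val_inj; exact/esym/(bool_algebra_mapE R s e).
by apply: bool_iso; [exact: yidem_inj|exact: yidem_surj].
Qed.

Lemma counit_nat_iso :
  nat_iso (comp_functor (functorS R) (functorI R)) (id_functor (Sp R)).
Proof.
exists (fun S : specker R => counit S); split=> [S T f|S].
  (* On the generator at [e], both composites give [f] applied to [val e]. *)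
  apply: bool_algebra_homP => e.
  rewrite [RHS](congr1 (f : algHom _ _) (counitE (e : idem (S : specker R)))).
  have fe := congr1 (counit T) (bool_algebra_mapE R (idem_hom f) e).
  exact: etrans fe (counitE _).
by apply: alg_iso; [exact: counit_inj|exact: counit_surj].
Qed.

End Indecomposable.

(** * The two-element Boolean algebra and the converse implications *)

Definition bool2 : boolAlg := BoolAlg bool.

Lemma bool2_idem (S : comPzRingType) (g : boolHom bool2 (idemBA S))
    (f : idemBA S -> bool2) :
  cancel f g -> forall x : S, x * x = x -> x = 0 \/ x = 1.
Proof.
move=> fK x /eqP xx; move: (fK (Idem xx)); case: (f _).
- by rewrite [LHS](bool_hom1 g) => -[<-]; right.
- by rewrite [LHS](bool_hom0 g) => -[<-]; left.
Qed.

Section TwoElements.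
Variable R : comNzRingType.

Local Notation R2 := (bool_algebra R bool2).

Lemma bool2_strP (p : R2) : exists a, p = alg_str R2 a.
Proof.
elim/bool_algebra_ind: p => [a|[]|_ _ [a ->] [b ->]|_ _ [a ->] [b ->]].
- by exists a.
- by exists 1; rewrite rmorph1; exact: yvar1.
- by exists 0; rewrite rmorph0; exact: yvar0.
- by exists (a + b); rewrite rmorphD.
- by exists (a * b); rewrite rmorphM.
Qed.

Lemma bool2_str_inj : injective (alg_str R2).
Proof.
move=> a b ab; apply/eqP; rewrite -subr_eq0; apply/eqP.
apply: (@yvar_neq0_faithful R bool2 \top%O _ isT).
by rewrite rmorphB ab subrr mul0r.
Qed.

Lemma indecomposable_of_unit :
  nat_iso (comp_functor (functorI R) (functorS R)) (id_functor BA) ->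
  indecomposable R.
Proof.
case=> eta [_ /(_ bool2)[inv [invK _]]] e ee.
pose f : boolHom (idemBA R2) bool2 := eta _.
pose g : boolHom bool2 (idemBA R2) := inv.
have fK : cancel f g.
  move=> x; exact: (congr1 (fun h : boolHom (idemBA _) (idemBA _) => h x) invK).
have strM : alg_str R2 e * alg_str R2 e = alg_str R2 e by rewrite -rmorphM ee.
have [e0|e1] := bool2_idem fK strM; [left|right]; apply: bool2_str_inj.
  by rewrite rmorph0.
by rewrite rmorph1.
Qed.

Lemma indecomposable_of_counit :
  nat_iso (comp_functor (functorS R) (functorI R)) (id_functor (Sp R)) ->
  indecomposable R.
Proof.
pose S := bool_specker R bool2.
case=> eta [_ /(_ S)[inv [invK _]]] e ee.
pose f : algHom (bool_algebra R (idemBA S)) S := eta S.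
have f_inj : injective f.
  apply: (can_inj (g := (inv : algHom S (bool_algebra R (idemBA S))))) => x.
  exact: (congr1 (fun h : algHom _ _ => h x) invK).
have Se : alg_str S e * alg_str S e == alg_str S e by rewrite -rmorphM ee.
pose i : idemBA S := Idem Se.
have [r fr] := bool2_strP (f (yvar R i)).
(* Since [f] preserves scalars, injectivity pulls the scalar back. *)
have {fr} yr : yvar R i = alg_str (bool_algebra R (idemBA S)) r.
  by apply: f_inj; rewrite fr alg_homC.
have [i0|/eqP i_n0] := eqVneq i \bot%O.
  by left; apply: bool2_str_inj; rewrite rmorph0; exact: (congr1 val i0).
have [i1|/eqP i_n1] := eqVneq (~` i)%O \bot%O.
  right; apply: bool2_str_inj; rewrite rmorph1; apply/esym/eqP.
  by rewrite -subr_eq0; apply/eqP; exact: (congr1 val i1).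
(* Now [i] and its complement are nonzero: the scalar [r] kills the faithful generator at the
   complement, so [r] is 0, and then 1 kills the one at [i]. *)
have /eqP : (1 : R) = 0; last by rewrite oner_eq0.
have r0 : r = 0.
  apply: (@yvar_neq0_faithful R _ (~` i)%O); first exact/eqP.
  by rewrite -yr -yvarI meetxC yvar0.
apply: (@yvar_neq0_faithful R _ i); first exact/eqP.
by rewrite yr r0 rmorph0 mulr0.
Qed.

End TwoElements.

Theorem theorem3p8 (R : comNzRingType) :
  [/\ indecomposable R <->
        nat_iso (comp_functor (functorI R) (functorS R)) (id_functor BA),
      indecomposable R <->
        nat_iso (comp_functor (functorS R) (functorI R)) (id_functor (Sp R)) &
      indecomposable R <-> yield_equivalence (functorI R) (functorS R)].
Proof.
split; split.
- by move=> Rind; apply: nat_iso_sym; exact: yhom_nat_iso.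
- exact: indecomposable_of_unit.
- exact: counit_nat_iso.
- exact: indecomposable_of_counit.
- move=> Rind; split; last exact: yhom_nat_iso.
  by apply: nat_iso_sym; exact: counit_nat_iso.
- by case=> _ /nat_iso_sym; exact: indecomposable_of_unit.
Qed.
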